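(* For any two graphs $G$ and $H$, $$\max\{\mathrm{mob}(G),\mathrm{mob}(H\vee K_1)\}\le \mathrm{mob}(G\odot H)\le \max\{n(G),\mathrm{gp}(H\vee K_1)\},$$ where $n(G)=|V(G)|$.
   Context: For graphs $G$ with $V(G)=\{v_1,\dots,v_n\}$ and $H$, the corona product $G\odot H$ is obtained from one copy of $G$ and $n$ disjoint copies $H^1,\dots,H^n$ of $H$ by joining $v_i$ to every vertex of $H^i$, for each $i$. The join $G\vee H$ is the disjoint union of $G$ and $H$ with all edges between $V(G)$ and $V(H)$ added. A set $S\subseteq V(G)$ is a general position set if no three vertices of $S$ lie on a common shortest path; $\mathrm{gp}(G)$ is the maximum size of such a set. Robots are placed one per vertex of a general position set $S$; a move $u\to v$ along an edge $uv$ with $u\in S$ is legal if $v\notin S$ and $(S\setminus\{u\})\cup\{v\}$ is a general position set. $S$ is a mobile general position set if some sequence of legal moves starting from $S$ visits every vertex at least once; $\mathrm{mob}(G)$ is the maximum size of a mobile general position set.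
   Formalization: G is taken to be nonempty, and the upper bound is stated only for connected G: it fails for G = 2K_1, H = K_2, where G⊙H = 2K_3 has mob 6 > 3, and the lower bound fails for empty G. *)

(* Defs.v *)
From mathcomp Require Import all_boot.
From mathcomp Require Import boolp.

Set Implicit Arguments.
Unset Strict Implicit.
Unset Printing Implicit Defensive.

Record sgraph := SGraph {
  vertex :> finType;
  adj : rel vertex;
  adj_sym : symmetric adj;
  adj_irrefl : irreflexive adj }.

Arguments adj {_}.

Definition connected_graph (G : sgraph) : Prop := forall x y : G, connect adj x y.

Section Complete.
Variable n : nat.

Definition complete_rel : rel 'I_n := fun i j => i != j.

Lemma complete_sym : symmetric complete_rel.
Proof. by move=> i j; rewrite /complete_rel eq_sym. Qed.

Lemma complete_irrefl : irreflexive complete_rel.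
Proof. by move=> i; rewrite /complete_rel eqxx. Qed.

Definition complete : sgraph := SGraph complete_sym complete_irrefl.
End Complete.

Section Products.
Variables G H : sgraph.

Definition join_rel : rel (G + H)%type := fun a b =>
  match a, b with
  | inl u, inl v => adj u v
  | inr x, inr y => adj x y
  | _, _ => true
  end.

Lemma join_sym : symmetric join_rel.
Proof. by move=> [u|x] [v|y] //=; apply: adj_sym. Qed.

Lemma join_irrefl : irreflexive join_rel.
Proof. by move=> [u|x] /=; apply: adj_irrefl. Qed.

Definition join : sgraph := SGraph join_sym join_irrefl.

(* [inl u] is the vertex u of G, and [inr (u, x)] is the vertex x of the copy *)
(* of H attached to u.                                                        *)
Definition corona_rel : rel (G + G * H)%type := fun a b =>
  match a, b with
  | inl u, inl v => adj u v
  | inl u, inr (v, _) => u == v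
  | inr (u, _), inl v => u == v
  | inr (u, x), inr (v, y) => (u == v) && adj x y
  end.

Lemma corona_sym : symmetric corona_rel.
Proof.
by move=> [u|[u x]] [v|[v y]] /=; rewrite ?[_ == u]eq_sym // adj_sym.
Qed.

Lemma corona_irrefl : irreflexive corona_rel.
Proof. by move=> [u|[u x]] /=; rewrite adj_irrefl ?andbF. Qed.

Definition corona : sgraph := SGraph corona_sym corona_irrefl.
End Products.

Section GeneralPosition.
Variable G : sgraph.

(* The vertices of the path are those of [x :: p]. *)
Definition shortest_path (x : G) (p : seq G) : Prop :=
  path adj x p /\
  forall q : seq G, path adj x q -> last x q = last x p -> size p <= size q.

Definition gp_set (S : {set G}) : bool :=
  `[< forall u v w : G, u \in S -> v \in S -> w \in S -> uniq [:: u; v; w] ->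
      ~ exists x p, shortest_path x p /\ {subset [:: u; v; w] <= x :: p} >].

Definition gp : nat := \max_(S : {set G} | gp_set S) #|S|.

Definition legal_move (S T : {set G}) : bool :=
  [exists u, exists v, [&& u \in S, adj u v, v \notin S,
     T == v |: (S :\ u) & gp_set T]].

(* The vertices occupied at the start count as visited. *)
Definition mobile_gp_set (S : {set G}) : bool :=
  `[< gp_set S /\ exists s : seq {set G}, path legal_move S s /\
      forall v : G, exists2 T, T \in S :: s & v \in T >].

Definition mob : nat := \max_(S : {set G} | mobile_gp_set S) #|S|.
End GeneralPosition.

(* Main.v *)
(* Legal moves are reversible, so a general position set is mobile as soon as   *)
(* every vertex can be visited by some excursion from it.                       *)
(*                                                                              *)
(* A tour of [G] carries over to the corona: distances in the corona do not     *)
(* change the betweenness of vertices in distinct fibres (a fibre being [v]     *)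
(* with its copy of [H]), so a robot at [v] may step into the copy at [v]. A    *)
(* tour of [join H K_1] is performed in one fibre; when the apex is occupied,   *)
(* its robot may leave and visit the other fibres, because it is equidistant    *)
(* from all the robots left behind. If [G] is disconnected, one extra robot is  *)
(* added in each of the other components.                                       *)
(*                                                                              *)
(* Conversely, if there are more than [n(G)] robots, some fibre holds two. Once *)
(* [v] is occupied together with another vertex of its fibre, no robot lies     *)
(* outside that fibre, since a shortest path out of it would pass through [v].  *)
(* So if there are more than [gp (join H K_1)] robots, the two robots can never *)
(* leave their copy of [H], and [v] is never visited.                           *)

Require Import Defs.
From mathcomp Require Import all_boot.
From mathcomp Require Import boolp zify.

Set Implicit Arguments.
Unset Strict Implicit.
Unset Printing Implicit Defensive.

(** All bounds come from distances. Common shortest paths are replaced by [between] ([gp_setP]), and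
    a tour by one excursion per vertex ([mobile_gp_setP]). In the corona, distance inside a fibre is
    that of the join ([dist_le_copy]); across distinct fibres it is the base distance plus the two
    heights ([dist_le_corona], [dist_le_coronaE]). The latter formula shows that sections of [base]
    keep general position ([gp_set_base], hence [mob_base_leq]), that a robot outside a fibre does
    not disturb those inside a copy of [H] ([gp_set_visitor], hence [mob_copy_leq] by
    [mobile_component]), and that an occupied base vertex cuts off its copy ([gp_set_crowded], hence
    [mob_corona_leq]). *)

Lemma connect_homo (T U : finType) (e : rel T) (e' : rel U) (f : T -> U) :
  (forall x y, e x y -> e' (f x) (f y)) ->
  forall x y, connect e x y -> connect e' (f x) (f y).
Proof.
move=> fP x y /connectP[p + ->] {y}.
elim: p x => [|z p IHp] x /=; first by rewrite connect0.
case/andP=> /fP xz /IHp; exact/connect_trans/connect1.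
Qed.

Lemma connect_invariant (T : finType) (e : rel T) (I : T -> Prop) :
  (forall x y, I x -> e x y -> I y) ->
  forall x y, I x -> connect e x y -> I y.
Proof.
move=> IP x y Ix /connectP[p + ->] {y}.
elim: p x Ix => [//|z p IHp] x Ix /= /andP[/(IP _ _ Ix) Iz]; exact: IHp.
Qed.

(** * Distance bounds and betweenness *)

Section Distance.
Variable G : sgraph.
Implicit Types (x y z u v w : G) (S T A B : {set G}).

(** A bound rather than a distance function, since the graph may be disconnected. *)
Definition dist_le x y n : Prop :=
  exists p, [/\ path adj x p, last x p = y & size p <= n].

Lemma dist_le0 x n : dist_le x x n.
Proof. by exists [::]. Qed.

Lemma dist_le1 x y : adj x y -> dist_le x y 1.
Proof. by move=> xy; exists [:: y]; rewrite /= xy. Qed.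

Lemma dist_le_gt0 x y n : x <> y -> dist_le x y n -> 0 < n.
Proof. by case: n => // xy [[|z p] [_ /= xz]]. Qed.

Lemma dist_le_trans y x z m n :
  dist_le x y m -> dist_le y z n -> dist_le x z (m + n).
Proof.
move=> [p [xp <- pm]] [q [pq <- qn]]; exists (p ++ q).
by rewrite cat_path last_cat xp pq size_cat leq_add.
Qed.

Lemma dist_leW x y m n : m <= n -> dist_le x y m -> dist_le x y n.
Proof. by move=> mn [p [xp py pm]]; exists p; split=> //; apply: leq_trans mn. Qed.

Lemma dist_le_sym x y n : dist_le x y n -> dist_le y x n.
Proof.
move=> [p [+ <- +]] {y}; elim: p x n => [|z p IHp] x n /=.
  by move=> *; apply: dist_le0.
case: n => // n /andP[xz zp] pn; rewrite -addn1.
by apply: dist_le_trans (IHp _ _ zp pn) _; apply: dist_le1; rewrite adj_sym.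
Qed.

Lemma dist_le_connect x y n : dist_le x y n -> connect adj x y.
Proof. by move=> [p [xp <- _]]; apply/connectP; exists p. Qed.

Lemma connect_dist_le x y : connect adj x y -> exists n, dist_le x y n.
Proof. by move=> /connectP[p xp ->]; exists (size p), p. Qed.

Lemma connect_min_dist x y : connect adj x y ->
  exists2 n, dist_le x y n & forall k, dist_le x y k -> n <= k.
Proof.
move=> /connect_dist_le[n xy].
have ex : exists n, `[< dist_le x y n >] by exists n; apply/asboolP.
case: (ex_minnP ex) => m /asboolP xym min; exists m => // k xyk.
by apply: min; apply/asboolP.
Qed.

Lemma connect_adj_sym : connect_sym (@adj G).
Proof. by apply: sym_connect_sym; apply: adj_sym. Qed.

(** Encodes d(u,v) + d(v,w) = d(u,w) with all distances finite: minimality forces [m] and [n] to be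
    exact. *)
Definition between u v w : Prop :=
  exists m n, [/\ dist_le u v m, dist_le v w n &
                  forall k, dist_le u w k -> m + n <= k].

Lemma between_sym u v w : between u v w -> between w v u.
Proof.
move=> [m [n [/dist_le_sym uv /dist_le_sym vw min]]].
by exists n, m; split=> // k /dist_le_sym/min; rewrite addnC.
Qed.

Lemma between_connect u v w :
  between u v w -> connect adj u v /\ connect adj u w.
Proof.
move=> [m [n [uv vw _]]]; split; first exact: dist_le_connect uv.
exact: dist_le_connect (dist_le_trans uv vw).
Qed.

Lemma dist_le_nth x p i j : path adj x p -> i <= j -> j <= size p ->
  dist_le (nth x (x :: p) i) (nth x (x :: p) j) (j - i).
Proof.
move=> xp ij; elim: j ij => [|j IHj] ij jp; first by case: i ij => //; exists [::].
case: (ltngtP i j.+1) ij => // [ij _|-> _]; last exact: dist_le0.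
rewrite subSn // -(addn1 (j - i)); apply: dist_le_trans (IHj ij (ltnW jp)) _.
exact/dist_le1/(pathP x xp).
Qed.

Lemma between_nth x p i j k : shortest_path x p -> i <= j <= k -> k <= size p ->
  between (nth x (x :: p) i) (nth x (x :: p) j) (nth x (x :: p) k).
Proof.
move=> [xp min] /andP[ij jk] kp; exists (j - i), (k - j); split.
- by apply: dist_le_nth => //; lia.
- exact: dist_le_nth.
move=> l ikl.
have ip : i <= size p by lia.
have xi := dist_le_nth xp (leq0n i) ip.
(* Replace the stretch from [i] to [k] by the given walk; the result cannot beat the shortest
   path. *)
have [q [xq qp qs]] :=
  dist_le_trans (dist_le_trans xi ikl) (dist_le_nth xp kp (leqnn _)).
have := min q xq; rewrite qp (nth_last x (x :: p)) => /(_ erefl); lia.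
Qed.

(** Two walks realising [between] concatenate to a shortest path; conversely, of three vertices on a
    shortest path, the one in middle position is between the others. *)
Lemma gp_setP S :
  reflect (forall u v w, u \in S -> v \in S -> w \in S -> uniq [:: u; v; w] ->
            ~ between u v w) (gp_set S).
Proof.
apply: (iffP (asboolP _)) => gpS u v w uS vS wS uvw.
  move=> [m [n [[p [up pv pm]] [q [vq qw qn]] min]]].
  apply: (gpS u v w) => //; exists u, (p ++ q); split; first split.
  - by rewrite cat_path up pv.
  - move=> r ur; rewrite last_cat pv qw => rw.
    by have := min _ (ex_intro _ r (And3 ur rw (leqnn _))); rewrite size_cat; lia.
  move=> z; rewrite !inE mem_cat => /or3P[]/eqP->; first by rewrite eqxx.
    by have := mem_last u p; rewrite pv inE => /orP[->|->] //; rewrite orbT.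
  by have := mem_last v q; rewrite qw -pv inE => /orP[/eqP->|->];
     rewrite ?orbT //; have := mem_last u p; rewrite inE => /orP[->|->] //;
     rewrite orbT.
move=> [x [p [xp sub]]].
have pos z : z \in [:: u; v; w] ->
    exists2 i, i <= size p & nth x (x :: p) i = z.
  move=> /sub zp; exists (index z (x :: p)); last exact: nth_index.
  by rewrite -ltnS -[(size p).+1]/(size (x :: p)) index_mem.
have [|i ip iu] := pos u; first by rewrite !inE eqxx.
have [|j jp jv] := pos v; first by rewrite !inE eqxx orbT.
have [|k kp kw] := pos w; first by rewrite !inE eqxx !orbT.
have no a b c l m n : nth x (x :: p) l = a -> nth x (x :: p) m = b ->
    nth x (x :: p) n = c -> a \in S -> b \in S -> c \in S ->
    uniq [:: a; b; c] -> n <= size p -> ~~ (l <= m <= n).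
  move=> la mb nc aS bS cS abc ns; apply/negP => lmn.
  by apply: (gpS a b c) => //; rewrite -la -mb -nc; apply: between_nth.
move: uvw; rewrite /= !inE !negb_or !andbT => /andP[/andP[uv uw] vw].
(* The three positions occur in one of six orders, each of which is excluded. *)
have := no _ _ _ _ _ _ iu jv kw uS vS wS.
have := no _ _ _ _ _ _ iu kw jv uS wS vS.
have := no _ _ _ _ _ _ jv iu kw vS uS wS.
have := no _ _ _ _ _ _ jv kw iu vS wS uS.
have := no _ _ _ _ _ _ kw iu jv wS uS vS.
have := no _ _ _ _ _ _ kw jv iu wS vS uS.
rewrite /= !inE !negb_or !andbT ![v == u]eq_sym ![w == u]eq_sym ![w == v]eq_sym.
rewrite uv uw vw ip jp kp /=.
do 6![move=> /(_ isT isT) ?].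
lia.
Qed.

(** * Legal moves and mobility *)

Lemma legal_moveP S T :
  reflect (exists u v, [/\ u \in S, adj u v, v \notin S,
             T = v |: (S :\ u) & gp_set T]) (legal_move S T).
Proof.
apply: (iffP existsP) => [[u /existsP[v /and5P[uS uv vS /eqP TE gpT]]]|].
  by exists u, v.
move=> [u [v [uS uv vS TE gpT]]]; exists u; apply/existsP; exists v.
by apply/and5P; split=> //; apply/eqP.
Qed.

Lemma legal_move_gp S T : legal_move S T -> gp_set T.
Proof. by case/legal_moveP=> u [v []]. Qed.

Lemma legal_move_sym S T : gp_set S -> legal_move S T -> legal_move T S.
Proof.
move=> gpS /legal_moveP[u [v [uS uv vS TE gpT]]].
have vu : v != u by apply: contraNneq vS => ->.
apply/legal_moveP; exists v, u; split=> //.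
- by rewrite TE setU11.
- by rewrite adj_sym.
- by rewrite TE !inE eqxx eq_sym (negPf vu).
by rewrite TE setU1K ?setD1K // !inE (negPf vS) andbF.
Qed.

Lemma legal_move_card S T : legal_move S T -> #|T| = #|S|.
Proof.
move=> /legal_moveP[u [v [uS _ vS -> _]]].
by rewrite cardsU1 !inE (negPf vS) andbF (cardsD1 u S) uS.
Qed.

Lemma connect_legal_gp S T :
  gp_set S -> connect (@legal_move G) S T -> gp_set T.
Proof.
by apply: (connect_invariant (I := fun T => gp_set T)) => A B _ /legal_move_gp.
Qed.

Lemma connect_legal_sym S T : gp_set S ->
  connect (@legal_move G) S T -> connect (@legal_move G) T S.
Proof.
move=> gpS ST.
pose I T := gp_set T /\ connect (@legal_move G) T S.
suff [] : I T by [].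
move: ST; apply: connect_invariant; last by split.
move=> A B [gpA AS] AB; split; first exact: legal_move_gp AB.
exact: connect_trans (connect1 (legal_move_sym gpA AB)) AS.
Qed.

(* Legal moves can be undone, so the excursions from [S] to the individual *)
(* vertices concatenate into a single tour.                                *)
Lemma mobile_gp_setP S :
  reflect (gp_set S /\
           forall v, exists2 T, connect (@legal_move G) S T & v \in T)
          (mobile_gp_set S).
Proof.
apply: (iffP (asboolP _)) => [[gpS [s [Ss vis]]]|[gpS vis]]; split=> //.
  move=> v; have [T TS vT] := vis v; exists T => //.
  exact: (path_connect Ss).
suff [s [Ss _ sP]] : exists s, [/\ path (@legal_move G) S s, last S s = S &
    forall v, v \in enum G -> exists2 T, T \in S :: s & v \in T].
  by exists s; split=> // v; apply: sP; rewrite mem_enum.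
elim: (enum G) => [|v l [s [Ss sS sP]]]; first by exists [::].
have [T ST vT] := vis v.
have /connectP[q Tq qS] := connect_legal_sym gpS ST.
move: ST => /connectP[p Sp pT].
exists (p ++ q ++ s); rewrite !cat_path !last_cat -pT -qS Sp Tq; split=> // w.
rewrite inE => /predU1P[->|/sP[U Us wU]].
  exists T => //; have := mem_last S p; rewrite -pT !inE !mem_cat.
  by case/orP=> ->; rewrite ?orbT.
by exists U => //; move: Us; rewrite !inE !mem_cat => /orP[]->; rewrite ?orbT.
Qed.

Lemma leq_gp S : gp_set S -> #|S| <= gp G.
Proof. by move=> gpS; apply: leq_bigmax_cond. Qed.

Lemma leq_mob S : mobile_gp_set S -> #|S| <= mob G.
Proof. by move=> mS; apply: leq_bigmax_cond. Qed.

Lemma mob_leq k : (forall S, mobile_gp_set S -> #|S| <= k) -> mob G <= k.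
Proof. by move=> le; apply/bigmax_leqP. Qed.

(** * Robots in separate components *)

Definition far A B : Prop :=
  (forall a b, a \in A -> b \in B -> ~~ connect adj a b) /\
  (forall b c, b \in B -> c \in B -> b != c -> ~~ connect adj b c).

(** Betweenness connects all three vertices, and a component met by [B] holds only one robot. *)
Lemma gp_setU_far A B : gp_set A -> far A B -> gp_set (A :|: B).
Proof.
move=> /gp_setP gpA [AB BB]; apply/gp_setP => u v w.
have sep b c : b \in B -> c \in A :|: B -> b != c -> ~~ connect adj b c.
  move=> bB /setUP[cA _|cB bc]; last exact: BB.
  by rewrite connect_adj_sym; apply: AB.
move=> uS vS wS uniq_uvw buvw; have [uv uw] := between_connect buvw.
have wv : connect adj w v by rewrite connect_adj_sym in uw; apply: connect_trans uv.
move: (uniq_uvw); rewrite /= !inE !negb_or !andbT => /andP[/andP[nuv nuw] nvw].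
case/setUP: (uS) => [uA|uB]; last by have := sep _ _ uB vS nuv; rewrite uv.
case/setUP: (vS) => [vA|vB]; last first.
  by have := sep _ _ vB wS nvw; rewrite connect_adj_sym wv.
case/setUP: (wS) => [wA|wB]; first exact: gpA buvw.
by have := sep _ _ wB vS; rewrite eq_sym nvw wv => /(_ isT).
Qed.

Lemma far_movel A B u v :
  u \in A -> adj u v -> far A B -> far (v |: (A :\ u)) B.
Proof.
move=> uA uv [AB BB]; split=> // a b /setU1P[->|/setD1P[_ aA]] bB; last exact: AB.
apply/negP => vb; have /negP[] := AB _ _ uA bB.
exact: connect_trans (connect1 uv) vb.
Qed.

Lemma far_mover A B u v :
  u \in B -> adj u v -> far A B -> far A (v |: (B :\ u)).
Proof.
move=> uB uv [AB BB]; split=> [a b aA|b c].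
  move=> /setU1P[->|/setD1P[_ bB]]; last exact: AB.
  apply/negP => av; have /negP[] := AB _ _ aA uB.
  by apply: connect_trans av _; rewrite connect_adj_sym connect1.
have uB' d : d \in B :\ u -> ~~ connect adj v d.
  move=> /setD1P[du dB]; have := BB _ _ uB dB; rewrite eq_sym du => /(_ isT).
  by apply: contra; apply: connect_trans; apply: connect1.
move=> /setU1P[->|bB] /setU1P[->|cB]; rewrite ?eqxx // => bc.
- exact: uB'.
- by rewrite connect_adj_sym; apply: uB'.
by case/setD1P: bB cB => _ bB /setD1P[_ cB]; apply: BB.
Qed.

Lemma far_notin A B a b : far A B -> a \in A -> connect adj a b -> b \notin B.
Proof. by move=> [AB _] aA ab; apply: contraTN ab; apply: AB. Qed.

Lemma connect_legal_setUl A A' B : gp_set A -> far A B ->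
  connect (@legal_move G) A A' ->
  far A' B /\ connect (@legal_move G) (A :|: B) (A' :|: B).
Proof.
move=> gpA fAB.
pose I A' := far A' B /\ connect (@legal_move G) (A :|: B) (A' :|: B).
apply: (connect_invariant (I := I)); last by split.
move=> C D [fCB AC] /legal_moveP[u [v [uC uv vC DE gpD]]].
have fDB : far D B by rewrite DE; apply: far_movel.
split=> //; apply: connect_trans AC _; apply: connect1.
have uB := far_notin fCB uC (connect0 _ _).
have vB := far_notin fCB uC (connect1 uv).
apply/legal_moveP; exists u, v; split=> //.
- by rewrite inE uC.
- by rewrite inE negb_or vC.
- rewrite DE setDUl setUA; congr (_ :|: _); apply/setP => x; rewrite !inE.
  by case: eqVneq => // ->; rewrite (negPf uB).
exact: gp_setU_far.
Qed.

Lemma connect_legal_setUr A B b c : gp_set A -> far A B -> b \in B ->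
  connect adj b c -> exists2 T, connect (@legal_move G) (A :|: B) T & c \in T.
Proof.
move=> gpA fAB bB bc.
pose I c := exists B', [/\ far A B', c \in B' &
  connect (@legal_move G) (A :|: B) (A :|: B')].
suff [B' [_ cB' BB']] : I c.
  by exists (A :|: B') => //; rewrite inE cB' orbT.
move: bc; apply: (connect_invariant (I := I)); last by exists B; rewrite connect0.
move=> u v [B' [fAB' uB' BB']] uv; exists (v |: (B' :\ u)).
have fAB'' := far_mover uB' uv fAB'.
split=> //; first by rewrite setU11.
apply: connect_trans BB' _; apply: connect1.
have vA : v \notin A.
  apply/negP => vA; have [/(_ _ _ vA uB')/negP[]] := fAB'.
  by rewrite connect_adj_sym connect1.
have uA : u \notin A by apply/negP => uA; have [/(_ _ _ uA uB')] := fAB'; rewrite connect0.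
apply/legal_moveP; exists u, v; split=> //.
- by rewrite inE uB' orbT.
- rewrite inE negb_or vA; apply/negP => vB'; have [_ /(_ _ _ uB' vB')] := fAB'.
  rewrite connect1 //; case: eqVneq uv => [->|]; first by rewrite adj_irrefl.
  by move=> _ _ /(_ isT).
- rewrite setDUl setUCA; congr (_ :|: (_ :|: _)); apply/setP => x; rewrite !inE.
  by case: eqVneq => // ->; rewrite (negPf uA).
exact: gp_setU_far.
Qed.

(* One robot per remaining component makes a set that is mobile within its *)
(* own component mobile in the whole graph.                                *)
Lemma mobile_component S x0 : gp_set S ->
  (forall x, x \in S -> connect adj x0 x) ->
  (forall v, connect adj x0 v ->
     exists2 T, connect (@legal_move G) S T & v \in T) ->
  #|S| <= mob G.
Proof.
move=> gpS S0 vis; pose B := [set root adj x | x in [pred x | ~~ connect adj x0 x]].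
have rootB b : b \in B -> ~~ connect adj x0 b /\ root adj b = b.
  case/imsetP=> x; rewrite inE => xP ->; split; last first.
    exact: (root_root connect_adj_sym).
  apply: contra xP => /connect_trans; apply.
  by rewrite connect_adj_sym connect_root.
have fSB : far S B.
  split=> [a b /S0 a0 /rootB[b0 _]|b c /rootB[_ rb] /rootB[_ rc]].
    by apply: contra b0; apply: connect_trans.
  by rewrite -(root_connect connect_adj_sym) rb rc.
apply: (@leq_trans #|S :|: B|); first by rewrite subset_leq_card ?subsetUl.
apply: leq_mob; apply/mobile_gp_setP; split; first exact: gp_setU_far.
move=> v; have [v0|v0] := boolP (connect adj x0 v).
  have [T ST vT] := vis _ v0; exists (T :|: B); last by rewrite inE vT.
  by have [_] := connect_legal_setUl gpS fSB ST.
apply: (connect_legal_setUr gpS fSB (b := root adj v)).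
  by apply: imset_f; rewrite inE.
by rewrite connect_adj_sym connect_root.
Qed.

End Distance.

(** * Graph maps *)

(** Collapsing an edge only shortens a walk; this allows retractions as well as embeddings. *)
Lemma dist_le_weak_homo (G H : sgraph) (f : G -> H) :
  (forall x y, adj x y -> f x = f y \/ adj (f x) (f y)) ->
  forall x y n, dist_le x y n -> dist_le (f x) (f y) n.
Proof.
move=> fP x y n [p [+ <- +]] {y}; elim: p x n => [|z p IHp] x n /=.
  by move=> *; apply: dist_le0.
case: n => // n /andP[/fP xz /IHp zp] /zp {}zp; rewrite -add1n.
case: xz => [->|xz]; last exact: dist_le_trans (dist_le1 xz) zp.
exact: dist_leW zp.
Qed.

Lemma legal_move_imset (G H : sgraph) (f : G -> H) (S T : {set G}) :
  injective f -> (forall x y, adj x y -> adj (f x) (f y)) ->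
  (gp_set T -> gp_set (f @: T)) ->
  legal_move S T -> legal_move (f @: S) (f @: T).
Proof.
move=> inj fP gpf /legal_moveP[u [v [uS uv vS TE gpT]]].
apply/legal_moveP; exists (f u), (f v); split.
- exact: imset_f.
- exact: fP.
- by rewrite mem_imset.
- rewrite TE imsetU1; congr (_ |: _); apply/setP => y.
  apply/imsetP/setD1P => [[x /setD1P[xu xS] ->]|[yu /imsetP[x xS yE]]].
    by rewrite inj_eq // imset_f.
  by exists x; rewrite // !inE xS andbT; apply: contraNneq yu; rewrite yE => ->.
exact: gpf.
Qed.

(** * Coordinates, distances and general position in the corona *)

Section Corona.
Variables G H : sgraph.

Notation J := (join H (complete 1)).
Notation C := (corona G H).
Implicit Types (a b c : C) (u v w : G) (x y : H).

(** A vertex is given by its fibre [base] and its place [local] in that fibre, a copy of [J] with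
    apex [inr ord0]; [height] is the distance to the apex. *)
Definition base a : G := match a with inl u => u | inr (u, _) => u end.
Definition height a : nat := if a is inr _ then 1 else 0.
Definition local a : J :=
  match a with inl _ => inr ord0 | inr (_, x) => inl x end.
Definition copy u (j : J) : C :=
  match j with inl x => inr (u, x) | inr _ => inl u end.

Lemma copyK u : cancel (copy u) local.
Proof. by case=> //= i; rewrite (ord1 i). Qed.

Lemma copy_inj u : injective (copy u).
Proof. exact: can_inj (copyK u). Qed.

Lemma base_copy u j : base (copy u j) = u.
Proof. by case: j. Qed.

Lemma localK a : copy (base a) (local a) = a.
Proof. by case: a => [|[]]. Qed.

Lemma inl_corona_inj : injective (inl : G -> C).
Proof. by move=> u v []. Qed.

Lemma adj_copy u j k : adj (copy u j) (copy u k) = adj j k.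
Proof.
by case: j k => [x|i] [y|k] //=; rewrite ?eqxx //= adj_irrefl (ord1 i) (ord1 k).
Qed.

Lemma dist_le_base a : dist_le a (inl (base a)) (height a).
Proof.
case: a => [u|[u x]]; first exact: dist_le0.
by apply: dist_le1; rewrite /= eqxx.
Qed.

Lemma dist_le_inl u v n : dist_le u v n -> dist_le (inl u : C) (inl v) n.
Proof.
by apply: (dist_le_weak_homo (f := inl : G -> C)) => ? ? ?; right.
Qed.

Lemma dist_le_join (j k : J) : dist_le j k 2.
Proof.
have c0 (l : J) : dist_le l (inr ord0) 1.
  case: l => [x|i]; first exact: dist_le1.
  by rewrite (ord1 i); apply: dist_le0.
exact: dist_le_trans (c0 j) (dist_le_sym (c0 k)).
Qed.

Lemma dist_le_copy u j k n : dist_le (copy u j) (copy u k) n <-> dist_le j k n.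
Proof.
split; last first.
  by apply: dist_le_weak_homo => {}j {}k jk; right; rewrite adj_copy.
(* The retraction onto the fibre of [u], sending all other fibres to the apex. *)
pose f a : J := if base a == u then local a else inr ord0.
rewrite -{2}(copyK u j) -{2}(copyK u k).
have fE l : local (copy u l) = f (copy u l) by rewrite /f base_copy eqxx.
rewrite !fE; apply: dist_le_weak_homo => -[v|[v x]] [w|[w y]] /=; rewrite /f /=.
- by left; rewrite !if_same.
- by move=> /eqP->; case: eqP; [right | left].
- by move=> /eqP->; case: eqP; [right | left].
by move=> /andP[/eqP-> xy]; case: eqP; [right | left].
Qed.

(* Leaving or entering the copy of [H] at a vertex costs one step. The bound *)
(* for equal bases is only there to make the induction on the walk work.     *)
Lemma dist_le_corona_proj a b n : dist_le a b n ->
  if base a == base b then (height b <= n + height a : Prop)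
  else exists2 m, dist_le (base a) (base b) m & m + height a + height b <= n.
Proof.
move=> [p [+ <- +]] {b}; elim: p a n => [|c p IHp] a n /=.
  by rewrite eqxx leq_addl.
case: n => // n /andP[ac /IHp cp] /cp {cp}; set b := last c p => IH.
have hle d : height d <= 1 by case: d.
have [ca|ca] := eqVneq (base a) (base c).
  rewrite -ca in IH; case: eqP IH => [_ _|_ [m am mn]].
    by have := hle b; lia.
  by exists m => //; have := hle a; lia.
(* Only edges of [G] change the fibre. *)
have [ha hc uv] : [/\ height a = 0, height c = 0 & adj (base a) (base c)].
  case: a c {IH b} ac ca => [u|[u x]] [v|[v y]] //=.
  - by move=> /eqP->; rewrite eqxx.
  - by move=> /eqP->; rewrite eqxx.
  by move=> /andP[/eqP->]; rewrite eqxx.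
rewrite ha hc in IH *; case: eqP => [ab|ab]; first by have := hle b; lia.
case: eqP IH => [<- bn|_ [m cb mn]].
  by exists 1; [exact: dist_le1 | lia].
exists m.+1; last by lia.
by rewrite -add1n; apply: dist_le_trans (dist_le1 uv) cb.
Qed.

Lemma dist_le_corona a b m : dist_le (base a) (base b) m ->
  dist_le a b (m + height a + height b).
Proof.
move=> ab; rewrite [m + _]addnC; apply: dist_le_trans.
  exact: dist_le_trans (dist_le_base a) (dist_le_inl ab).
exact/dist_le_sym/dist_le_base.
Qed.

Lemma dist_le_coronaE a b n : base a <> base b -> dist_le a b n ->
  exists2 m, dist_le (base a) (base b) m & m + height a + height b <= n.
Proof. by move=> ab /dist_le_corona_proj; case: eqP. Qed.

Lemma gp_set_copy u (T : {set J}) : gp_set (copy u @: T) = gp_set T.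
Proof.
have E i j k : between (copy u i) (copy u j) (copy u k) <-> between i j k.
  by split=> -[m [n [ij jk min]]]; exists m, n; split;
     try (by apply/dist_le_copy; eassumption);
     move=> l /dist_le_copy ik; apply: min.
apply/gp_setP/gp_setP => gpT i j k.
  move=> iT jT kT ijk /E; apply: gpT; rewrite ?imset_f //.
  by move: ijk; rewrite /= !inE !(inj_eq (@copy_inj u)).
move=> /imsetP[i' iT ->] /imsetP[j' jT ->] /imsetP[k' kT ->] ijk /E.
by apply: gpT => //; move: ijk; rewrite /= !inE !(inj_eq (@copy_inj u)).
Qed.

(** The heights of the end vertices cancel and that of the middle one only lengthens the detour, so
    betweenness descends to the bases. *)
Lemma gp_set_base (S : {set C}) :
  {in S &, injective base} -> gp_set (base @: S) -> gp_set S.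
Proof.
move=> inj /gp_setP gpS; apply/gp_setP => a b c aS bS cS abc.
move=> [m [n [ab bc min]]].
move: abc; rewrite /= !inE !negb_or !andbT => /andP[/andP[nab nac] nbc].
have neq d e : d \in S -> e \in S -> d != e -> base d != base e.
  by move=> dS eS; apply: contra => /eqP/inj->.
have nab' := neq _ _ aS bS nab; have nbc' := neq _ _ bS cS nbc.
have [k abk km] := dist_le_coronaE (elimN eqP nab') ab.
have [l bcl ln] := dist_le_coronaE (elimN eqP nbc') bc.
apply: (gpS (base a) (base b) (base c)); rewrite ?imset_f //.
  by rewrite /= !inE negb_or nab' nbc' neq.
exists k, l; split=> // i /dist_le_corona/min; lia.
Qed.

Lemma gp_set_section (f : G -> C) (S : {set G}) :
  cancel f base -> gp_set S -> gp_set (f @: S).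
Proof.
move=> fK gpS; apply: gp_set_base; last by rewrite -imset_comp (eq_imset _ fK) imset_id.
by move=> a b /imsetP[u _ ->] /imsetP[v _ ->]; rewrite !fK => ->.
Qed.

(** * Lower bound from [G] *)

Lemma mob_base_leq : mob G <= mob C.
Proof.
apply: mob_leq => S /mobile_gp_setP[gpS vis].
rewrite -(card_imset (mem S) inl_corona_inj).
apply: leq_mob; apply/mobile_gp_setP; split; first exact: gp_set_section.
move=> a; have [T ST aT] := vis (base a).
have gpT := connect_legal_gp gpS ST.
have {}ST : connect (@legal_move C) (inl @: S) (inl @: T).
  move: ST; apply: (connect_homo (f := fun S : {set G} => (inl : G -> C) @: S)).
  move=> A B; apply: legal_move_imset => //; first exact: inl_corona_inj.
  exact: gp_set_section.
case: a aT => [u|[u x]] /= uT; first by exists (inl @: T); rewrite ?imset_f.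
exists (inr (u, x) |: ((inl : G -> C) @: T :\ inl u)); last by rewrite setU11.
apply: connect_trans ST (connect1 _); apply/legal_moveP.
exists (inl u), (inr (u, x)); split=> //.
- exact: imset_f.
- by rewrite /= eqxx.
- by apply/imsetP => -[].
(* The section of [base] that lifts only [u]; its image is the position after the step into the
   copy. *)
pose f v : C := if v == u then inr (u, x) else inl v.
have fK : cancel f base by move=> v; rewrite /f; case: eqP.
suff -> : inr (u, x) |: ((inl : G -> C) @: T :\ inl u) = f @: T.
  exact: gp_set_section.
apply/setP => a; apply/setU1P/imsetP => [[->|/setD1P[au /imsetP[v vT aE]]]|].
- by exists u; rewrite // /f eqxx.
- exists v => //; rewrite /f; case: eqVneq => // vu.
  by rewrite aE vu eqxx in au.
move=> [v vT ->]; rewrite /f; case: eqP => [_|vu]; [by left | right].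
by rewrite !inE imset_f // andbT; apply/eqP => -[].
Qed.

(** * Lower bound from the join *)

(** The robots in the copy are equidistant from [a], so none is between [a] and another; and a route
    between two of them through [a] has length at least 4, while they are within distance 2. *)
Lemma gp_set_visitor u (T : {set J}) a : gp_set T -> inr ord0 \notin T ->
  base a <> u -> gp_set (a |: copy u @: T).
Proof.
move=> gpT cT au; have /gp_setP gpT' : gp_set (copy u @: T) by rewrite gp_set_copy.
have TP b : b \in copy u @: T -> base b = u /\ height b = 1.
  move=> /imsetP[j jT ->]; rewrite base_copy; split=> //.
  by case: j jT => // i; rewrite (ord1 i) (negPf cT).
have end_no b c : b \in copy u @: T -> c \in copy u @: T -> b <> c ->
    ~ between a b c.
  move=> /TP[bu hb] /TP[cu hc] bc [m [n [ab /(dist_le_gt0 bc) n0 min]]].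
  have [|k abk km] := dist_le_coronaE _ ab; first by rewrite bu.
  have /min : dist_le a c (k + height a + height c).
    by apply: dist_le_corona; rewrite cu -bu.
  by lia.
apply/gp_setP => b c d /setU1P[->|bT] /setU1P[->|cT'] /setU1P[->|dT];
  rewrite /= !inE ?eqxx ?orbT ?andbF //= ?negb_or ?andbT => bcd.
- by apply: end_no => //; apply/eqP; case/andP: bcd.
- move=> [m [n [ba ad min]]].
  case: (TP _ bT) (TP _ dT) => [bu hb] [du hd].
  have [|k bak km] := dist_le_coronaE _ ba; first by rewrite bu => /esym.
  have [|l adl ln] := dist_le_coronaE _ ad; first by rewrite du.
  have k0 : 0 < k by apply: dist_le_gt0 bak; rewrite bu => /esym.
  have l0 : 0 < l by apply: dist_le_gt0 adl; rewrite du.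
  have /min : dist_le b d 2.
    by rewrite -(localK b) -(localK d) bu du; apply/dist_le_copy/dist_le_join.
  by lia.
- move=> /between_sym; apply: end_no => //; apply/eqP.
  by rewrite eq_sym; case/andP: bcd => /andP[].
by apply: gpT' => //; rewrite /= !inE negb_or andbT.
Qed.

Lemma mob_copy_leq u0 : mob J <= mob C.
Proof.
apply: mob_leq => S /mobile_gp_setP[gpS vis].
rewrite -(card_imset (mem S) (@copy_inj u0)).
have lift T : connect (@legal_move J) S T ->
    connect (@legal_move C) (copy u0 @: S) (copy u0 @: T).
  apply: (connect_homo (f := fun S : {set J} => copy u0 @: S)) => A B.
  apply: legal_move_imset; first exact: copy_inj.
    by move=> j k; rewrite adj_copy.
  by rewrite gp_set_copy.
apply: (@mobile_component C _ (inl u0)); first by rewrite gp_set_copy.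
  move=> a /imsetP[j _ ->]; rewrite connect_adj_sym.
  by have := dist_le_connect (dist_le_base (copy u0 j)); rewrite base_copy.
move=> a /connect_dist_le[n ua].
case: (eqVneq (base a) u0) => [au|/eqP au].
  have [T ST aT] := vis (local a); exists (copy u0 @: T); first exact: lift.
  by rewrite -(localK a) au imset_f.
have [T ST cT] := vis (inr ord0); have gpT := connect_legal_gp gpS ST.
(* The robots that stay put while the apex robot travels. *)
pose Q := copy u0 @: (T :\ inr ord0).
have QP z : z \in Q -> base z = u0 /\ z != inl u0.
  move=> /imsetP[j /setD1P[jc _] ->]; rewrite base_copy; split=> //.
  by case: j jc => // i; rewrite (ord1 i) eqxx.
have QT : inl u0 |: Q = copy u0 @: T.
  by rewrite -[inl u0]/(copy u0 (inr ord0)) -imsetU1 setD1K.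
(* The places open to the traveller; [gpQ] makes every move between adjacent ones legal. *)
pose free (z : C) := z = inl u0 \/ base z <> u0.
have freeQ (z : C) : free z -> z \notin Q.
  by move=> zP; apply/negP => /QP[zu zn]; case: zP => // zE; rewrite zE eqxx in zn.
have gpQ (z : C) : free z -> gp_set (z |: Q).
  case=> [->|zu]; first by rewrite QT gp_set_copy.
  apply: gp_set_visitor => //; last by rewrite !inE eqxx.
  move: gpT => /gp_setP gpT; apply/gp_setP => i j k.
  by move=> /setD1P[_ iT] /setD1P[_ jT] /setD1P[_ kT]; apply: gpT.
have move_free (z z' : C) : free z -> free z' -> adj z z' ->
    legal_move (z |: Q) (z' |: Q).
  move=> zP zP' zz'; apply/legal_moveP; exists z, z'; split=> //.
  - by rewrite setU11.
  - rewrite !inE negb_or freeQ // andbT; apply: contraTneq zz' => ->.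
    by rewrite adj_irrefl.
  - by rewrite setU1K ?freeQ.
  exact: gpQ.
have free_inl v : free (inl v).
  by rewrite /free; case: (eqVneq v u0) => [->|/eqP]; [left|right].
exists (a |: Q); last by rewrite setU11.
apply: connect_trans (lift _ ST) _; rewrite -QT.
have [|m ubm _] := dist_le_coronaE _ ua; first by move=> /esym.
apply: (@connect_trans _ _ (inl (base a) |: Q)).
  move: (dist_le_connect ubm); apply: (connect_homo (f := fun v => (inl v : C) |: Q)).
  by move=> v w vw; apply: move_free.
case: a {ua} au ubm => [v|[v x]] /= au _; first exact: connect0.
by apply: connect1; apply: move_free => //; [right | rewrite /= eqxx].
Qed.

(** * Upper bound *)

(* A robot at [v] cuts a robot in the copy of [H] at [v] off from all the *)
(* other fibres.                                                          *)
Lemma gp_set_crowded v x (T : {set C}) : connected_graph G ->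
  gp_set T -> inl v \in T -> inr (v, x) \in T -> #|T| <= gp J.
Proof.
move=> conn gpT vT xT.
have TE : T = copy v @: (local @: T).
  suff fib a : a \in T -> base a = v.
    rewrite -imset_comp -[LHS]imset_id; apply: eq_in_imset => a /fib <- /=.
    by rewrite localK.
  move=> aT; apply/eqP/negPn/negP => av.
  have [m vam min] := connect_min_dist (conn v (base a)).
  move: gpT => /gp_setP/(_ (inr (v, x)) (inl v) a xT vT aT) [].
    have nv b : base b = v -> b != a by move=> bv; apply: contraNneq av => <-; apply/eqP.
    by rewrite /= !inE negb_or !nv.
  exists 1, (m + height a); split.
  - by apply: dist_le1; rewrite /= eqxx.
  - by have := @dist_le_corona (inl v) a m vam; rewrite /= addn0.
  move=> k /dist_le_coronaE[|l /min ml] /=; last by lia.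
  by move=> /esym/eqP; apply/negP.
rewrite TE (card_imset _ (@copy_inj v)); apply: leq_gp.
by rewrite -(gp_set_copy v) -TE.
Qed.

Lemma mob_corona_leq : connected_graph G -> mob C <= maxn #|G| (gp J).
Proof.
move=> conn; apply: mob_leq => S /mobile_gp_setP[gpS vis].
rewrite leq_max; case: leqP => //= GS; rewrite leqNgt; apply/negP => JS.
have cutP (T : {set C}) v x : gp_set T -> #|T| = #|S| -> inr (v, x) \in T -> inl v \notin T.
  move=> gpT TS xT; apply/negP => vT.
  by have := gp_set_crowded conn gpT vT xT; rewrite TS leqNgt JS.
have /dinjectivePn[a aS [b]] : ~~ dinjectiveb base (mem S).
  apply/negP => /dinjectiveP/card_in_imset E.
  by move: GS; rewrite -E ltnNge max_card.
rewrite !inE => /andP[ba bS] ab.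
pose crowded v (T : {set C}) :=
  exists x y, [/\ x != y, inr (v, x) \in T & inr (v, y) \in T].
(* By [cutP], neither of two robots in one fibre stands on its base vertex. *)
have [v crowdS] : exists v, crowded v S.
  case: a b aS bS ba ab => [u|[u x]] [v|[v y]] aS bS /= ba ab.
  - by rewrite ab eqxx in ba.
  - by have := cutP _ _ _ gpS erefl bS; rewrite -ab aS.
  - by have := cutP _ _ _ gpS erefl aS; rewrite ab bS.
  exists u, x, y; split=> //; last by rewrite ab.
  by apply: contraNneq ba => ->; rewrite ab.
(* Preserved by legal moves, and by [cutP] incompatible with a robot at [inl v]. *)
pose I T := [/\ gp_set T, #|T| = #|S| & crowded v T].
have step T T' : I T -> legal_move T T' -> I T'.
  move=> [gpT TS [x [y [xy xT yT]]]] TT'.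
  have gpT' := legal_move_gp TT'; have T'S := etrans (legal_move_card TT') TS.
  split=> //; move: TT' => /legal_moveP[c [d [cT cd dT TE _]]].
  have stay e : e \in T -> e != c -> e \in T' by move=> eT ec; rewrite TE !inE eT ec orbT.
  have dT' : d \in T' by rewrite TE setU11.
  (* A robot leaving the copy would enter [v] while another one is left behind. *)
  have slide (z w : H) : z != w -> inr (v, z) \in T -> inr (v, w) \in T ->
      c = inr (v, z) -> crowded v T'.
    move=> zw zT wT cE.
    have wT' : inr (v, w) \in T'.
      by apply: stay => //; rewrite cE; apply: contra zw => /eqP[->].
    have := cutP _ _ _ gpT' T'S wT'; move: cd dT dT'; rewrite cE.
    case: d {TE} => [d|[d z']] /=; first by move=> /eqP<- _ ->.
    move=> /andP[/eqP<- _] zT'' zT' _; exists z', w; split=> //.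
    by apply: contraNneq zT'' => ->.
  have [cx|cx] := eqVneq c (inr (v, x)); first exact: (slide x y).
  have [cy|cy] := eqVneq c (inr (v, y)); first by apply: (slide y x); rewrite 1?eq_sym.
  by exists x, y; split=> //; apply: stay => //; rewrite eq_sym.
have [T ST vT] := vis (inl v).
have [gpT TS [x [y [_ xT _]]]] := connect_invariant step (And3 gpS erefl crowdS) ST.
by have := cutP _ _ _ gpT TS xT; rewrite vT.
Qed.

End Corona.

Theorem theorem4p1 (G H : sgraph) (hG : 0 < #|G|) :
  maxn (mob G) (mob (join H (complete 1))) <= mob (corona G H) /\
  (connected_graph G ->
    mob (corona G H) <= maxn #|G| (gp (join H (complete 1)))).
Proof.
have /card_gt0P[u0 _] := hG.
split; last exact: mob_corona_leq.
by rewrite geq_max mob_base_leq (mob_copy_leq H u0).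
Qed.
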